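(* Let $S\subset\mathbb N_0$ be nonempty, $\theta\in(0,1)$, and assume $h_{\mathrm{top}}(X_S)>0$. Let $\mu_0$ be the unique measure of maximal entropy of $(X_S,\sigma)$, and let $C_{\mathrm{eff}}>0$ be a constant such that $$\left|\int f\,d\mu-\int f\,d\mu_0\right|\le C_{\mathrm{eff}}\|f\|_\theta\sqrt{h_{\mathrm{top}}(X_S)-h_\mu(\sigma)}$$ for every $\sigma$-invariant Borel probability measure $\mu$ on $X_S$ and every $f\in C^\theta(X_S)$. Let $C=[w]\subset X_S$ be the cylinder determined by an admissible word $w$ of length $\ell\ge1$, with $\mu_0(C)>0$, let $\mathcal E_C=\{x\in X_S:\sigma^kx\notin C\text{ for every }k\ge0\}$, and set $$\kappa_C=\frac{\mu_0(C)^2}{C_{\mathrm{eff}}^2\|\mathbf 1_C\|_\theta^2},\qquad \widehat\kappa_C=\min\left\{\kappa_C,\tfrac12h_{\mathrm{top}}(X_S)\right\}.$$ Then $\widehat\kappa_C>0$ and $$\dim_H(\mathcal E_C,d_\theta)\le\frac{h_{\mathrm{top}}(X_S)-\widehat\kappa_C}{-\log\theta}<\frac{h_{\mathrm{top}}(X_S)}{-\log\theta}.$$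
   Context: $\mathbb N_0=\{0,1,2,\dots\}$. For nonempty $S\subset\mathbb N_0$, the one-sided $S$-gap shift $X_S\subset\{0,1\}^{\mathbb N_0}$ is the set of all $x=(x_k)_{k\ge0}$ such that whenever two consecutive (i.e. successive) symbols $1$ occur in $x$, the number of zeros between them belongs to $S$; it contains $0^\infty=000\cdots$, and $\sigma$ is the left shift. For $\theta\in(0,1)$ put $d_\theta(x,y)=\theta^{t(x,y)}$, $t(x,y)=\min\{k\ge0:x_k\ne y_k\}$, $d_\theta(x,x)=0$. $C^\theta(X_S)$ is the space of bounded real functions with $\|f\|_\theta=\|f\|_\infty+|f|_\theta<\infty$, where $|f|_\theta=\sup_{x\ne y}|f(x)-f(y)|/d_\theta(x,y)$. Cylinders: $[w]=\{x\in X_S:x_0\cdots x_{\ell-1}=w\}$; $\mathbf 1_C$ is the indicator of $C$. $h_\mu(\sigma)$ is measure-theoretic entropy, $h_{\mathrm{top}}$ topological entropy, and a measure of maximal entropy is a $\sigma$-invariant Borel probability measure $\mu$ with $h_\mu(\sigma)=h_{\mathrm{top}}(X_S)$. When $h_{\mathrm{top}}(X_S)>0$ there is exactly one such measure, and a constant $C_{\mathrm{eff}}$ as in the claim exists. $\dim_H(Z,d_\theta)$ is the Hausdorff dimension of $Z$ with respect to the metric $d_\theta$, with $\dim_H(\emptyset)=0$. *)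

(* Defs.v *)
From HB Require Import structures.
From mathcomp Require Import all_boot all_order all_algebra.
From mathcomp Require Import all_classical all_reals all_analysis.

Set Implicit Arguments.
Unset Strict Implicit.
Unset Printing Implicit Defensive.

Import Order.TTheory GRing.Theory Num.Theory.

Local Open Scope classical_set_scope.
Local Open Scope ring_scope.

(* A point of [cantor_space] is a sequence [nat -> bool]; [true] stands for the
   symbol 1 and [false] for the symbol 0. *)
Definition gap_shift (S : set nat) : set cantor_space :=
  [set x : nat -> bool | forall i j : nat, (i < j)%N -> x i -> x j ->
     (forall k : nat, (i < k < j)%N -> ~~ x k) -> S (j - i.+1)%N].

Definition gap_space (S : set nat) : Type := set_type (gap_shift S).

HB.instance Definition _ (S : set nat) := Topological.on (gap_space S).

Lemma gap_shift_zero (S : set nat) : gap_shift S (fun=> false).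
Proof. by []. Qed.

HB.instance Definition _ (S : set nat) :=
  isPointed.Build (gap_space S)
    (exist _ (fun=> false) (mem_set (@gap_shift_zero S))).

Definition symbol (S : set nat) (x : gap_space S) (k : nat) : bool :=
  (val x : nat -> bool) k.

Lemma gap_shift_shift (S : set nat) (x : nat -> bool) :
  gap_shift S x -> gap_shift S (fun k => x k.+1).
Proof.
move=> Sx i j ij xi xj zeros; rewrite -subSS; apply: Sx => // -[//|k].
by rewrite !ltnS; exact: zeros.
Qed.

Definition sigma (S : set nat) (x : gap_space S) : gap_space S :=
  exist _ (fun k => symbol x k.+1)
    (mem_set (gap_shift_shift (set_mem (valP x)))).

(* X_S with its Borel sigma-algebra, for the topology induced by the product
   topology of {0,1}^N (which is the topology of every [d_theta] below). *)
Definition borel_gap_space (S : set nat) :=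
  g_sigma_algebraType (@open (gap_space S)).

Definition d_theta (R : realType) (theta : R) (S : set nat)
    (x y : gap_space S) : R :=
  match pselect (exists k, symbol x k != symbol y k) with
  | left differ => theta ^+ ex_minn differ
  | right _ => 0
  end.

Definition admissible (S : set nat) (w : seq bool) : Prop :=
  exists (x : gap_space S) (k : nat),
    mkseq (fun i => symbol x (k + i)%N) (size w) = w.

Definition cylinder (S : set nat) (w : seq bool) : set (gap_space S) :=
  [set x | mkseq (symbol x) (size w) = w].

Arguments d_theta {R} theta {S} x y.
Arguments sigma {S} x.
Arguments cylinder S w : clear implicits.

Definition escape_set (X : Type) (T : X -> X) (C : set X) : set X :=
  [set x | forall k : nat, ~ C (iter k T x)].

Section holder_norm.
Context {R : realType} {X : Type} (d : X -> X -> R).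
Local Open Scope ereal_scope.

Definition sup_norm (f : X -> R) : \bar R :=
  ereal_sup (range (fun x => `|f x|%:E)).

(* The diagonal pairs only contribute 0 / 0 = 0. *)
Definition holder_seminorm (f : X -> R) : \bar R :=
  ereal_sup (range (fun p : X * X => (`|f p.1 - f p.2| / d p.1 p.2)%:E)).

Definition holder_norm (f : X -> R) : \bar R :=
  sup_norm f + holder_seminorm f.

End holder_norm.

Definition invariant_measure (R : realType) (disp : measure_display)
    (X : measurableType disp) (mu : probability X R) (T : X -> X) : Prop :=
  forall A : set X, measurable A -> mu (T @^-1` A) = mu A.

Section measure_entropy.
Context {R : realType} {disp : measure_display} {X : measurableType disp}.
Variables (mu : probability X R) (T : X -> X).
Local Open Scope ereal_scope.

(* A finite measurable partition is given by its labelling [xi : X -> 'I_m];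
   the atoms are the fibres of [xi], some of which may be empty. *)
Definition measurable_labelling (m : nat) (xi : X -> 'I_m) : Prop :=
  forall i : 'I_m, measurable (xi @^-1` [set i]).

(* The atom with itinerary [a] of the join of the T^-i xi, for i < n. *)
Definition join_atom (m : nat) (xi : X -> 'I_m) (n : nat)
    (a : {ffun 'I_n -> 'I_m}) : set X :=
  [set x | forall i : 'I_n, xi (iter i T x) = a i].

(* Here [ln 0 = 0], so that null atoms contribute 0. *)
Definition join_entropy (m : nat) (xi : X -> 'I_m) (n : nat) : R :=
  (\sum_(a : {ffun 'I_n -> 'I_m})
     let p := fine (mu (join_atom xi a)) in - (p * ln p))%R.

(* For an invariant [mu] the upper limit is a limit, by subadditivity. *)
Definition partition_entropy (m : nat) (xi : X -> 'I_m) : \bar R :=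
  limn_esup (fun n => (join_entropy xi n / n%:R)%:E).

Definition measure_entropy : \bar R :=
  ereal_sup [set h | exists (m : nat) (xi : X -> 'I_m),
    measurable_labelling xi /\ h = partition_entropy xi].

End measure_entropy.

Section topological_entropy.
Context {R : realType} {X : eqType} (d : X -> X -> R) (T : X -> X).
Local Open Scope ereal_scope.

Definition separated (n : nat) (eps : R) (E : seq X) : Prop :=
  uniq E /\ {in E &, forall x y, x != y ->
    exists2 k, (k < n)%N & (eps < d (iter k T x) (iter k T y))%R}.

Definition ln_separated (n : nat) (eps : R) : \bar R :=
  ereal_sup [set (ln (size E)%:R)%:E | E in separated n eps].

(* The growth rate is nonincreasing in [eps], so that the supremum over [eps]
   is the limit for [eps] going to 0. *)
Definition topological_entropy : \bar R :=
  ereal_sup [set limn_esup (fun n => (n%:R^-1)%:E * ln_separated n eps)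
            | eps in [set eps : R | (0 < eps)%R]].

End topological_entropy.

Section hausdorff.
Context {R : realType} {X : Type} (d : X -> X -> R).
Local Open Scope ereal_scope.

(* The element 0 makes the diameter of the empty set equal to 0. *)
Definition diameter (U : set X) : \bar R :=
  ereal_sup (0 |` [set e | exists x y : X, [/\ U x, U y & e = (d x y)%:E]]).

Definition delta_cover (delta : R) (Z : set X) (U : nat -> set X) : Prop :=
  Z `<=` \bigcup_i U i /\ forall i, diameter (U i) <= delta%:E.

Definition hausdorff_content (s delta : R) (Z : set X) : \bar R :=
  ereal_inf [set \sum_(0 <= i <oo) diameter (U i) `^ s
            | U in delta_cover delta Z].

Definition hausdorff_measure (s : R) (Z : set X) : \bar R :=
  ereal_sup [set hausdorff_content s delta Z
            | delta in [set delta : R | (0 < delta)%R]].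

Definition hausdorff_dim (Z : set X) : \bar R :=
  ereal_inf [set s%:E | s in
    [set s : R | (0 < s)%R /\ hausdorff_measure s Z = 0]].

End hausdorff.

Section gap_entropies.
Context {R : realType} (S : set nat).

(* This does not depend on [theta] in (0, 1). *)
Definition h_top (theta : R) : \bar R :=
  topological_entropy (@d_theta R theta S) (@sigma S).

Definition h_mu (mu : probability (borel_gap_space S) R) : \bar R :=
  measure_entropy mu (@sigma S).

Definition max_entropy_measure (theta : R)
    (mu : probability (borel_gap_space S) R) : Prop :=
  invariant_measure mu (@sigma S) /\ h_mu mu = h_top theta.

(* [sqrte] is 0 on negative arguments; they do not occur, since
   h_mu <= h_top < +oo by the variational principle. *)
Definition effective_constant (theta : R)
    (mu0 : probability (borel_gap_space S) R) (Ceff : R) : Prop :=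
  forall (mu : probability (borel_gap_space S) R) (f : gap_space S -> R),
    invariant_measure mu (@sigma S) ->
    (holder_norm (@d_theta R theta S) f < +oo)%E ->
    (`|\int[mu]_x f x - \int[mu0]_x f x|%:E <=
      Ceff%:E * holder_norm (@d_theta R theta S) f *
      sqrte (h_top theta - h_mu mu))%E.

(* Both [fine] are applied to finite quantities. *)
Definition kappa (theta : R) (mu0 : probability (borel_gap_space S) R)
    (Ceff : R) (C : set (gap_space S)) : R :=
  fine (mu0 C) ^+ 2 /
  (Ceff ^+ 2 * fine (holder_norm (@d_theta R theta S) (\1_C)) ^+ 2).

Definition kappa_hat (theta : R) (mu0 : probability (borel_gap_space S) R)
    (Ceff : R) (C : set (gap_space S)) : \bar R :=
  mine (kappa theta mu0 Ceff C)%:E ((2^-1)%:E * h_top theta)%E.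

End gap_entropies.

(* Main.v *)
Require Import Defs.
From HB Require Import structures.
From mathcomp Require Import all_boot all_order all_algebra.
From mathcomp Require Import all_classical all_reals all_analysis.
From mathcomp Require Import ring lra zify.

Set Implicit Arguments.
Unset Strict Implicit.
Unset Printing Implicit Defensive.

Import Order.TTheory GRing.Theory Num.Theory.
Import numFieldNormedType.Exports.

Local Open Scope classical_set_scope.
Local Open Scope ring_scope.

(** Let E be the set of points whose orbit avoids C, and let L(N) be the number
of words of length N that are prefixes of points of E.  The L(N) cylinders of
these words cover E and have diameter at most theta^N.  So if L(N) < e^(N D) for
infinitely many N, then E has dimension at most D / (- log theta)
([hausdorff_measure_eq0]).

If on the contrary L(N) >= e^(N D) for all large N, then, since sigma E is
contained in E, there is an invariant probability mu with h_mu >= D that gives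
no mass to the cylinders disjoint from E, in particular to C
([exists_entropy_measure]).  The effective inequality for mu and the indicator
of C then reads mu0(C) <= Ceff ||1_C|| sqrt(h_top - h_mu), that is
D <= h_top - kappa_C ([entropy_gap]).  Hence every D > h_top - kappa_hat is in
the first case, which is the bound on the dimension.  The cut at h_top / 2 keeps
that bound nonnegative, so that it also holds for empty E, and the finiteness of
h_top ([h_top_le]) makes the last inequality strict.

The measure mu is the one of Misiurewicz's proof of the variational principle.
Choose a point of E in the cylinder of each word of length N, average the point
masses along the first N steps of their orbits, and let N go to infinity along
an ultrafilter.  This defines the weights m(a) of the cylinders [a], which are
consistent, shift invariant and zero off E ([limit_weights]).

The usual entropy estimate, which cuts words into blocks and uses that entropy
is subadditive and concave, is replaced by one application of Gibbs'
inequality: the uniform distribution on the L(N) chosen points is compared with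
a q-step Markov chain, whose transition probabilities, multiplied along words of
length q + N, give weights that add up to at most 2^q over distinct words
([ln_size_le]).  For the chain whose transition
probabilities are m(a s) / m(a) the limit inequality is D <= H(q+1) - H(q), with
H(q) the entropy of m on words of length q.  It telescopes to q D <= H(q)
([word_entropy_ge]), and H(q) / q is the quotient that defines the entropy of mu
for the partition by the first symbol ([measure_entropy_ge]).

Finally m is extended to a Borel measure without an extension theorem: the
words of length n, in lexicographic order, cut [0, 1[ into intervals of lengths
m(a), these subdivisions are nested in n, and mu is the image of Lebesgue
measure under the map that reads off the resulting symbol sequence
([exists_cylinder_probability]). *)

(** * Words and windows *)

Fixpoint words (n : nat) : seq (seq bool) :=
  if n is n'.+1 then
    flatten [seq [:: rcons a false; rcons a true] | a <- words n']
  else [:: [::]].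

Lemma mem_words n a : (a \in words n) = (size a == n).
Proof.
elim: n a => [|n IHn] a /=; first by rewrite inE size_eq0.
elim/last_ind: a => [|a b _].
  by apply/flattenP => -[_ /mapP[a _ ->]]; rewrite !inE; case: a.
rewrite size_rcons eqSS -IHn; apply/flattenP/idP => [[_ /mapP[a' a'n ->]]|an].
  by rewrite !inE => /orP[] /eqP /rcons_inj[-> _].
exists [:: rcons a false; rcons a true]; first exact: map_f.
by rewrite !inE; case: b; rewrite eqxx ?orbT.
Qed.

Lemma big_wordsS (R : realType) n (F : seq bool -> R) :
  \sum_(a <- words n.+1) F a =
  \sum_(a <- words n) (F (rcons a false) + F (rcons a true)).
Proof.
rewrite /= big_flatten big_map; apply: eq_bigr => a _.
by rewrite !big_cons big_nil /= addr0.
Qed.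

Lemma size_words n : size (words n) = (2 ^ n)%N.
Proof.
elim: n => //= n IHn; rewrite size_flatten /shape -map_comp sumnE big_map /=.
by rewrite big_const_seq count_predT iter_addn_0 IHn expnS.
Qed.

Lemma uniq_words n : uniq (words n).
Proof.
elim: n => //= n; elim: (words n) => //= a s IH /andP[as_ /IH{}IH].
have nin b : rcons a b \notin flatten [seq [:: rcons a false; rcons a true] | a <- s].
  apply/flattenP => -[_ /mapP[a' a's ->]]; rewrite !inE => /orP[] /eqP.
    by move=> /rcons_inj[aa' _]; rewrite aa' a's in as_.
  by move=> /rcons_inj[aa' _]; rewrite aa' a's in as_.
by rewrite /= inE negb_or !nin eqseq_rcons andbF IH.
Qed.

Definition window (x : nat -> bool) (k n : nat) : seq bool :=
  mkseq (fun i => x (k + i)%N) n.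

Lemma size_window x k n : size (window x k n) = n.
Proof. exact: size_mkseq. Qed.

Lemma windowS x k n : window x k n.+1 = rcons (window x k n) (x (k + n)%N).
Proof. by rewrite /window mkseqS. Qed.

Lemma window_cons x k n : window x k n.+1 = x k :: window x k.+1 n.
Proof.
rewrite /window /mkseq /= addn0; congr (_ :: _).
by rewrite -[1%N]addn0 iotaDl -map_comp; apply: eq_map => i /=; rewrite addnA addn1.
Qed.

Lemma window_prefix x i n N : (i + n <= N)%N ->
  window x i n = take n (drop i (window x 0 N)).
Proof.
move=> inN; apply: (@eq_from_nth _ false) => [|j].
  by rewrite size_window size_takel// size_drop size_window; lia.
by rewrite size_window => jn; rewrite nth_mkseq// nth_take// nth_drop nth_mkseq//; lia.
Qed.

(** * Gibbs' inequality against a Markov chain *)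

Section markov_weight.
Context {R : realType} (q : nat) (c : seq bool -> R).

Definition markov_weight (N : nat) (a : seq bool) : R :=
  \prod_(i < N) c (take q.+1 (drop i a)).

Hypothesis c_sum : forall a, size a = q -> c (rcons a false) + c (rcons a true) = 1.

(** The last symbol of a word enters only the last factor, and there the two
possible values of [c] add up to 1; only the free choice of the first [q]
symbols remains. *)
Lemma sum_markov_weight N :
  \sum_(a <- words (q + N)) markov_weight N a = 2 ^+ q.
Proof.
elim: N => [|N IHN].
  rewrite addn0 (eq_bigr (fun=> 1)); last by move=> a _; rewrite /markov_weight big_ord0.
  by rewrite big_const_seq count_predT size_words iter_addr_0 natrX.
rewrite addnS big_wordsS -IHN; apply: eq_big_seq => a; rewrite mem_words => /eqP sa.
have step b : markov_weight N.+1 (rcons a b) =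
    markov_weight N a * c (rcons (drop N a) b).
  rewrite /markov_weight big_ord_recr /=; congr (_ * c _).
    apply: eq_bigr => i _; have iN := ltn_ord i.
    rewrite drop_rcons; last by rewrite sa; lia.
    by rewrite -cats1 takel_cat// size_drop sa; lia.
  rewrite drop_rcons; last by rewrite sa; lia.
  by rewrite take_oversize// size_rcons size_drop sa; lia.
by rewrite !step -mulrDr c_sum ?mulr1// size_drop sa addnK.
Qed.

End markov_weight.

Lemma sum_cst (R : realType) (I : Type) (s : seq I) (a : R) :
  \sum_(i <- s) a = (size s)%:R * a.
Proof. by rewrite big_const_seq count_predT iter_addr_0 mulr_natl. Qed.

Lemma ler_sum_sub (R : realType) (I : eqType) (s t : seq I) (F : I -> R) :
  uniq s -> uniq t -> {subset s <= t} -> (forall i, 0 <= F i) ->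
  \sum_(i <- s) F i <= \sum_(i <- t) F i.
Proof.
move=> us ut st F0; rewrite [leRHS](bigID (mem s))/= -[X in _ <= X + _]big_filter.
have -> : \sum_(i <- [seq i <- t | i \in s]) F i = \sum_(i <- s) F i.
  apply: perm_big; apply: uniq_perm => //; first exact: filter_uniq.
  move=> i; rewrite mem_filter; case: (boolP (i \in s)) => //= /st ->//.
by rewrite lerDl sumr_ge0.
Qed.

Section gibbs.
Context {R : realType} (q : nat) (c : seq bool -> R).
Hypothesis c_sum : forall a, size a = q -> c (rcons a false) + c (rcons a true) = 1.
Hypothesis c_gt0 : forall a, 0 < c a.

(** Gibbs' inequality for the uniform distribution on [P] and the Markov weights,
in the form ln y <= y - 1 summed over [P].  The weights are those of the windows
of length [q + N]: these are distinct since already their prefixes of length [N]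
are, so that [sum_markov_weight] bounds their sum, and looking beyond position
[N] gives exactly [N] factors. *)
Lemma ln_size_le (N : nat) (P : seq (nat -> bool)) :
  (0 < size P)%N -> uniq [seq window x 0 N | x <- P] ->
  (size P)%:R * ln (size P)%:R <=
  (size P)%:R * (q%:R * ln 2) +
    \sum_(x <- P) \sum_(i < N) - ln (c (window x i q.+1)) :> R.
Proof.
move=> P0 uP; set M := (size P)%:R.
have M0 : 0 < M by rewrite ltr0n.
pose W x := \prod_(i < N) c (window x i q.+1).
have W0 x : 0 < W x by apply: prodr_gt0.
have sumW : \sum_(x <- P) W x <= 2 ^+ q.
  rewrite -(sum_markov_weight c_sum N).
  rewrite (eq_bigr (fun x => markov_weight q c N (window x 0 (q + N)))); last first.
    move=> x _; apply: eq_bigr => i _; congr c; have iN := ltn_ord i.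
    by rewrite (@window_prefix x i q.+1 (q + N))//; lia.
  rewrite -(big_map (fun x => window x 0 (q + N)) predT (markov_weight q c N)).
  apply: ler_sum_sub.
  - apply: (@map_uniq _ _ (take N)); rewrite -map_comp.
    rewrite (@eq_map _ _ _ (fun x => window x 0 N))// => x /=.
    by rewrite (@window_prefix x 0 N (q + N)) ?drop0//; lia.
  - exact: uniq_words.
  - by move=> a /mapP[x _ ->]; rewrite mem_words size_window.
  - by move=> a; apply: prodr_ge0 => i _; exact: ltW.
have lnW n x : ln (\prod_(i < n) c (window x i q.+1)) =
               \sum_(i < n) ln (c (window x i q.+1)).
  elim: n => [|n IHn]; first by rewrite !big_ord0 ln1.
  by rewrite !big_ord_recr/= lnM ?posrE ?prodr_gt0// IHn.
have lnx1 (y : R) : 0 < y -> ln y <= y - 1.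
  by move=> y0; rewrite -[y in ln y](subrKC 1) le_ln1Dx// ltrBrDl addrN.
have e0 : 0 < 2 ^+ q :> R by rewrite exprn_gt0.
have le1 : \sum_(x <- P) (ln M - q%:R * ln 2 + ln (W x)) <=
            \sum_(x <- P) (M / 2 ^+ q * W x - 1).
  apply: ler_sum => x _; apply: le_trans (lnx1 _ _); last by rewrite mulr_gt0 ?divr_gt0.
  rewrite lnM ?posrE ?divr_gt0// ln_div ?posrE// lnXn// mulr_natl.
  by rewrite lexx.
rewrite big_split /= [leRHS]big_split/= sumrN -mulr_sumr in le1.
rewrite !sum_cst -/M in le1.
have le2 : M / 2 ^+ q * (\sum_(x <- P) W x) <= M.
  by rewrite -mulrA ger_pMr// ler_pdivrMl// mulr1.
have -> : \sum_(x <- P) \sum_(i < N) - ln (c (window x i q.+1)) =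
          - \sum_(x <- P) ln (W x).
  by rewrite -sumrN; apply: eq_bigr => x _; rewrite /W lnW sumrN.
lra.
Qed.

End gibbs.

(** * Empirical weights of cylinders *)

Definition word_of (E : set (nat -> bool)) (a : seq bool) : Prop :=
  exists2 x, E x & window x 0 (size a) = a.

Definition language (E : set (nat -> bool)) (n : nat) : seq (seq bool) :=
  [seq a <- words n | `[< word_of E a >]].

Lemma word_of_window (E : set (nat -> bool)) x k n :
  (forall y, E y -> E (fun i => y i.+1)) -> E x -> word_of E (window x k n).
Proof.
move=> Eshift Ex; exists (fun i => x (k + i)%N); last by rewrite size_window.
elim: k => [|k IHk]; first by rewrite (_ : (fun _ => _) = x)//; apply/funext.
by under eq_fun do rewrite addSnnS; exact: Eshift IHk.
Qed.

Section empirical_measure.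
Context {R : realType} (E : set (nat -> bool)) (pt : seq bool -> nat -> bool).
Hypothesis Eshift : forall x, E x -> E (fun i => x i.+1).
Hypothesis E_pt : forall b, word_of E b -> E (pt b).
Hypothesis pt_prefix : forall b, word_of E b -> window (pt b) 0 (size b) = b.

(** The mass of the cylinder of [a] under the average of the point masses at
sigma^i (pt b), over the words [b] of length [N] and the times i < N. *)
Definition empirical (N : nat) (a : seq bool) : R :=
  (\sum_(b <- language E N) \sum_(i < N) (window (pt b) i (size a) == a)%:R) /
  (N%:R * (size (language E N))%:R).

Lemma empirical_ge0 N a : 0 <= empirical N a.
Proof.
rewrite divr_ge0 ?mulr_ge0//; apply: sumr_ge0 => b _; apply: sumr_ge0 => i _.
by rewrite ler0n.
Qed.

Lemma empirical_le1 N a : empirical N a <= 1.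
Proof.
have [z|nz] := eqVneq (N%:R * (size (language E N))%:R : R) 0.
  by rewrite /empirical z invr0 mulr0.
rewrite ler_pdivrMr ?lt0r ?nz ?mulr_ge0// mul1r mulrC -sum_cst.
apply: ler_sum => b _; rewrite -[N in leRHS]card_ord -sum1_card natr_sum.
apply: ler_sum => i _.
by rewrite ler_nat leq_b1.
Qed.

Lemma empirical_nil N : (0 < N)%N -> (0 < size (language E N))%N ->
  empirical N [::] = 1.
Proof.
move=> N0 L0; rewrite /empirical.
under eq_bigr do under eq_bigr do rewrite eqxx.
under eq_bigr do rewrite -natr_sum sum1_card card_ord.
rewrite sum_cst [X in X / _]mulrC divff//.
by rewrite mulf_neq0// pnatr_eq0 -lt0n.
Qed.

Lemma empirical_rcons N a :
  empirical N a = empirical N (rcons a false) + empirical N (rcons a true).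
Proof.
rewrite /empirical -mulrDl -big_split; congr (_ / _); apply: eq_bigr => b _ /=.
rewrite -big_split; apply: eq_bigr => i _ /=.
rewrite !size_rcons windowS !eqseq_rcons; case: (_ == a) => //=; last by rewrite addr0.
by case: (pt b _); rewrite ?addr0 ?add0r.
Qed.

(** Shifting an orbit segment of length [N] changes only its two end points, so
the empirical weights are invariant up to 1 / N. *)
Lemma empirical_cons N a : (0 < N)%N ->
  `|empirical N a - (empirical N (false :: a) + empirical N (true :: a))| <=
  N%:R^-1.
Proof.
move=> N0; have [z|nz] := eqVneq (size (language E N))%:R (0 : R).
  by rewrite /empirical z mulr0 invr0 !mulr0 addr0 subrr normr0 invr_ge0.
have N0' : N%:R != 0 :> R by rewrite pnatr_eq0 -lt0n.
rewrite /empirical -!mulrDl -mulrBl -big_split -sumrB/=.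
rewrite normrM normfV [X in _ / X]ger0_norm ?mulr_ge0//.
rewrite ler_pdivrMr ?lt0r ?mulf_neq0 ?mulr_ge0// mulKf//.
apply: le_trans (ler_norm_sum _ _ _) _.
rewrite -[leRHS]mulr1 -sum_cst; apply: ler_sum => b _.
have e i : (window (pt b) i (size a).+1 == false :: a)%:R +
    (window (pt b) i (size a).+1 == true :: a)%:R =
    (window (pt b) i.+1 (size a) == a)%:R :> R.
  rewrite window_cons !eqseq_cons; case: (_ == a) => //=; last by rewrite !andbF addr0.
  by case: (pt b _); rewrite ?addr0 ?add0r.
rewrite -big_split/=; under [X in _ - X]eq_bigr do rewrite e.
pose g (i : nat) : R := (window (pt b) i (size a) == a)%:R.
rewrite -sumrB -(big_mkord xpredT (fun i => g i - g i.+1)).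
have -> : \sum_(0 <= i < N) (g i - g i.+1) = g 0%N - g N.
  by rewrite -[LHS]opprK -sumrN; under eq_bigr do rewrite opprB;
     rewrite telescope_sumr// opprB.
rewrite /g; case: (_ == a); case: (_ == a);
  rewrite ?subrr ?subr0 ?sub0r ?normrN ?normr1 ?normr0 //.
Qed.

Lemma empirical_eq0 N a : ~ word_of E a -> empirical N a = 0.
Proof.
move=> na; rewrite /empirical big_seq big1 ?mul0r// => b.
rewrite mem_filter => /andP[/asboolP wb _]; apply: big1 => i _.
case: eqP => // fa; case: na; rewrite -fa; apply: word_of_window => //.
exact: E_pt.
Qed.

Lemma sum_empirical N n (g : seq bool -> R) :
  \sum_(a <- words n) empirical N a * g a =
  (\sum_(b <- language E N) \sum_(i < N) g (window (pt b) i n)) /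
  (N%:R * (size (language E N))%:R).
Proof.
under eq_bigr do rewrite /empirical mulrAC; rewrite -mulr_suml; congr (_ / _).
under eq_bigr do rewrite mulr_suml; rewrite exchange_big; apply: eq_bigr => b _ /=.
under eq_bigr do rewrite mulr_suml; rewrite exchange_big; apply: eq_bigr => i _ /=.
rewrite (bigD1_seq (window (pt b) i n)) ?mem_words ?size_window ?uniq_words//=.
rewrite eqxx mul1r big_seq_cond big1 ?addr0// => a /andP[].
by rewrite mem_words => /eqP -> /negbTE; rewrite eq_sym => ->; rewrite mul0r.
Qed.

(** [ln_size_le] for the chosen points, with the sum along the orbits rewritten
as an integral against the empirical weights. *)
Lemma ln_language_le (q N : nat) (c : seq bool -> R) :
  (forall a, size a = q -> c (rcons a false) + c (rcons a true) = 1) ->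
  (forall a, 0 < c a) -> (0 < N)%N -> (0 < size (language E N))%N ->
  ln (size (language E N))%:R / N%:R <=
  (q%:R * ln 2) * N%:R^-1 + \sum_(a <- words q.+1) empirical N a * - ln (c a).
Proof.
move=> c1 c0 N0 L0; rewrite sum_empirical.
have := @ln_size_le R q c c1 c0 N [seq pt b | b <- language E N].
rewrite size_map -map_comp; set M := (size _)%:R => /(_ L0) H.
have M0 : 0 < M by rewrite ltr0n.
have N0' : 0 < N%:R :> R by rewrite ltr0n.
have /H {}H : uniq [seq window (pt b) 0 N | b <- language E N].
  rewrite map_id_in ?filter_uniq ?uniq_words// => b.
  rewrite mem_filter mem_words => /andP[/asboolP wb /eqP <-].
  exact: pt_prefix.
rewrite !big_map in H.
rewrite -(ler_pM2l M0) -(ler_pM2l N0').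
have -> : N%:R * (M * (ln M / N%:R)) = M * ln M by field; rewrite gt_eqF.
set T := \sum_(b <- _) _ in H *.
have -> : N%:R * (M * (q%:R * ln 2 / N%:R + T / (N%:R * M))) =
  M * (q%:R * ln 2) + T by field; rewrite !gt_eqF.
exact: H.
Qed.

End empirical_measure.

(** * The limit weights *)

Lemma ultra_cvg_itv (R : realType) (T : Type) (U : set_system T) (f : T -> R) (a b : R) :
  UltraFilter U -> (forall t, a <= f t <= b) -> exists l : R, f @ U --> l.
Proof.
move=> UU fab.
have UfU : UltraFilter ((f @ U) : set_system R).
  split=> [|G GF fUG]; first exact: fmap_proper_filter.
  rewrite predeqE => A; split=> [GA|]; last exact: fUG.
  have [//|UnA] := in_ultra_setVsetC (f @^-1` A) UU.
  have /filter_ex[? []//] : G (A `&` ~` A).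
  by apply: filterI => //; apply: fUG; move: UnA; rewrite preimage_setC.
have := @segment_compact R a b; rewrite compact_ultra => /(_ _ UfU).
case=> [|l [_ fl]]; last by exists l.
by apply: (@filterE T U _ (f @^-1` `[a, b])) => t /=; rewrite in_itv/= fab.
Qed.

(** The conditions under which the numbers [m a] are the masses that some Borel
probability on the full shift gives to the cylinders. *)
Definition cylinder_weights (R : realType) (m : seq bool -> R) : Prop :=
  [/\ forall a, 0 <= m a, m [::] = 1 &
      forall a, m a = m (rcons a false) + m (rcons a true)].

(** All relations between the empirical weights involve finitely many words, so
each passes to the limit along an ultrafilter; the errors 1 / N and
q ln 2 / N disappear. *)
Lemma limit_weights (R : realType) (E : set (nat -> bool)) (D : R) (N0 : nat) :
  (forall x, E x -> E (fun i => x i.+1)) ->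
  (forall N, (N0 <= N)%N -> expR (N%:R * D) <= (size (language E N))%:R) ->
  exists m : seq bool -> R,
    [/\ cylinder_weights m,
        forall a, m a = m (false :: a) + m (true :: a),
        forall a, ~ word_of E a -> m a = 0 &
        forall (q : nat) (c : seq bool -> R),
          (forall a, size a = q -> c (rcons a false) + c (rcons a true) = 1) ->
          (forall a, 0 < c a) ->
          D <= \sum_(a <- words q.+1) m a * - ln (c a)].
Proof.
move=> Eshift Egrowth.
have /choice[pt ptP] : forall b, exists x,
    word_of E b -> E x /\ window x 0 (size b) = b.
  move=> b; have [[x Ex xb]|nb] := pselect (word_of E b); first by exists x.
  by exists (fun=> false).
pose mu := @empirical R E pt.
have [U [UU ooU]] := ultraFilterLemma (F := \oo) _.
have /choice[m mP] : forall a, exists l : R, mu N a @[N --> U] --> l.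
  move=> a; apply: (@ultra_cvg_itv _ _ _ _ 0 1) => // N.
  by rewrite empirical_ge0 empirical_le1.
have nearU (P : set nat) : (\forall N \near \oo, P N) -> \forall N \near U, P N.
  exact: ooU.
have L0 N : (N0 <= N)%N -> (0 < size (language E N))%N.
  by move=> /Egrowth; rewrite -(ltr_nat R); apply: lt_le_trans; rewrite expR_gt0.
have invN : N%:R^-1 @[N --> U] --> (0 : R).
  suff : (N%:R^-1 : R) @[N --> \oo] --> (0 : R) by move=> h A /h /ooU.
  by rewrite -(@cvg_shiftS R (fun N => N%:R^-1)); exact: cvg_harmonic.
have limE u v : mu^~ u @ U --> v -> m u = v.
  by move=> /(@cvg_unique _ (@norm_hausdorff R R) _ _ _ _ (mP u)).
exists m; split.
- split=> [a||a].
  + by apply: (cvgr_to_ge (mP a)); apply: nearW => N; exact: empirical_ge0.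
  + apply: limE; apply: cvg_near_cst; apply: nearU; near=> N.
    apply: empirical_nil; last by apply: L0; near: N; exact: nbhs_infty_ge.
    by near: N; exact: nbhs_infty_gt.
  + apply: limE; under eq_fun do rewrite /mu empirical_rcons.
    by apply: cvgD; exact: mP.
- move=> a; apply/eqP; rewrite -subr_eq0 -normr_le0.
  have h : `|mu N a - (mu N (false :: a) + mu N (true :: a))| @[N --> U] -->
           `|m a - (m (false :: a) + m (true :: a))|.
    by apply: cvg_norm; apply: cvgB; [|apply: cvgD]; exact: mP.
  apply: (ler_cvg_to h invN); apply: nearU; near=> N.
  by apply: empirical_cons; near: N; exact: nbhs_infty_gt.
- move=> a na; apply: limE; apply: cvg_near_cst; apply: nearW => N.
  by apply: empirical_eq0 => // b /ptP[].
- move=> q c c1 c0.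
  have h : (q%:R * ln 2) * N%:R^-1 + \sum_(a <- words q.+1) mu N a * - ln (c a)
     @[N --> U] --> (q%:R * ln 2) * 0 + \sum_(a <- words q.+1) m a * - ln (c a).
    apply: cvgD; first by apply: cvgMl_tmp.
    apply: cvg_big => [|a _]; first exact: add_continuous.
    by apply: cvgMr_tmp; exact: mP.
  rewrite mulr0 add0r in h; apply: (cvgr_to_ge h); apply: nearU; near=> N.
  have N_gt0 : (0 < N)%N by near: N; exact: nbhs_infty_gt.
  have N0N : (N0 <= N)%N by near: N; exact: nbhs_infty_ge.
  apply: le_trans (ln_language_le _ c1 c0 N_gt0 (L0 _ N0N)).
    rewrite ler_pdivlMr ?ltr0n// mulrC -[leLHS]expRK ler_ln ?posrE ?expR_gt0 ?ltr0n ?L0//.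
    exact: Egrowth.
  by move=> b /ptP[].
Unshelve. all: by end_near. Qed.

(** * Entropy of the limit weights *)

Definition word_entropy (R : realType) (m : seq bool -> R) (n : nat) : R :=
  \sum_(a <- words n) - (m a * ln (m a)).

(** Adding [d] inside the logarithm removes the singularity at 0 at the price of
an error that is uniform in [x]. *)
Lemma mul_ln_shift (R : realType) (x d : R) : 0 <= x -> 0 < d ->
  x * ln x <= x * ln (x + d) <= x * ln x + d.
Proof.
rewrite le_eqVlt => /predU1P[<-|x0] d0; first by rewrite !mul0r lexx add0r ltW.
have xd0 : 0 < x + d by rewrite addr_gt0.
rewrite ler_pM2l// ler_ln ?posrE// lerDl ltW//= -lerBlDl -mulrBr -ln_div ?posrE//.
rewrite mulrDl divff ?gt_eqF// mulrC -ler_pdivlMr// le_ln1Dx//.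
by rewrite (lt_trans (ltrN10 _))// divr_gt0.
Qed.

(** Applied to the conditional weights of [m], the hypothesis bounds the
conditional entropy H(q+1) - H(q) from below by [D], and H(0) = 0. *)
Lemma word_entropy_ge (R : realType) (m : seq bool -> R) (D : R) (n : nat) :
  cylinder_weights m ->
  (forall (q : nat) (c : seq bool -> R),
     (forall a, size a = q -> c (rcons a false) + c (rcons a true) = 1) ->
     (forall a, 0 < c a) ->
     D <= \sum_(a <- words q.+1) m a * - ln (c a)) ->
  n%:R * D <= word_entropy m n.
Proof.
move=> [m0 m1 mS] Dc.
suff step q : D <= word_entropy m q.+1 - word_entropy m q.
  elim: n => [|n IHn].
    by rewrite mul0r /word_entropy big_cons big_nil m1 ln1 mulr0 oppr0 addr0.
  by have := step n; rewrite mulrSr; lra.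
have pq : 0 < 2 ^+ q *+ 2 :> R by rewrite mulrn_wgt0// exprn_gt0.
apply/ler_addgt0Pr => e e0; pose d := e / (2 ^+ q *+ 2).
have d0 : 0 < d by rewrite divr_gt0.
(* A word that occurs in the empirical measures can have limit weight 0, so the
   conditional weights m(b s) / m(b) are smoothed to stay positive. *)
pose c a := (m a + d) / (m (take q a) + d *+ 2).
have num0 a : 0 < m a + d by rewrite ltr_wpDl.
have den0 a : 0 < m a + d *+ 2 by rewrite ltr_wpDl// pmulrn_rgt0.
apply: le_trans (Dc q c _ _) _.
- move=> a sa; rewrite /c -!cats1 !take_cat sa ltnn subnn !take0 !cats0 !cats1.
  rewrite -mulrDl addrACA -mS -mulr2n divff//; exact: lt0r_neq0.
- by move=> a; rewrite divr_gt0.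
have -> : \sum_(a <- words q.+1) m a * - ln (c a) =
    \sum_(a <- words q.+1) - (m a * ln (m a + d)) +
    \sum_(a <- words q) m a * ln (m a + d *+ 2).
  have -> : \sum_(a <- words q) m a * ln (m a + d *+ 2) =
      \sum_(a <- words q.+1) m a * ln (m (take q a) + d *+ 2).
    rewrite big_wordsS; apply: eq_big_seq => a; rewrite mem_words => /eqP sa.
    by rewrite -!cats1 !take_cat sa ltnn subnn !take0 !cats0 !cats1 -mulrDl -mS.
  rewrite -big_split; apply: eq_bigr => a _ /=.
  by rewrite /c ln_div ?posrE//; ring.
have H1 : \sum_(a <- words q.+1) - (m a * ln (m a + d)) <= word_entropy m q.+1.
  apply: ler_sum => a _; rewrite lerN2.
  by have /andP[] := mul_ln_shift (m0 a) d0.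
have d20 : 0 < d *+ 2 by rewrite pmulrn_rgt0.
have H2 : \sum_(a <- words q) m a * ln (m a + d *+ 2) <= e - word_entropy m q.
  have -> : e = \sum_(a <- words q) (d *+ 2).
    by rewrite sum_cst size_words natrX /d; field; rewrite gt_eqF ?exprn_gt0.
  rewrite /word_entropy -sumrB; apply: ler_sum => a _; rewrite opprK.
  by have /andP[_] := mul_ln_shift (m0 a) d20; rewrite [leRHS]addrC.
lra.
Qed.

(** * Cylinders and the Borel sets *)

(** Convergence in the product topology is coordinatewise, so the filter of the
cylinders around [x] converges to [x]. *)
Lemma nbhs_cantor_window (x : cantor_space) (B : set cantor_space) :
  nbhs x B -> exists n, forall y : cantor_space,
    window y 0 n = window x 0 n -> B y.
Proof.
pose C n := [set y : cantor_space | window y 0 n = window x 0 n].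
have window_le i n (y : nat -> bool) : (i < n)%N -> window y 0 n = window x 0 n ->
    y i = x i.
  by move=> lt_in /(congr1 (nth false ^~ i)); rewrite !nth_mkseq.
have FF : Filter (filter_from setT C).
  apply: filter_from_filter; first by exists 0%N.
  move=> i j _ _; exists (maxn i j) => // y /= xy.
  have sub k : (k <= maxn i j)%N -> window y 0 k = window x 0 k.
    by move=> kij; rewrite !(@window_prefix _ 0 k (maxn i j))// xy.
  by split; apply: sub; rewrite ?leq_maxl ?leq_maxr.
have Fx : filter_from setT C --> (x : cantor_space).
  apply/cvg_sup => i A; rewrite nbhsE => -[_ [[V oV <-] Vx] sVA].
  exists i.+1 => // y /= xy; apply: sVA.
  by have := window_le i i.+1 y (ltnSn _) xy; rewrite /= => ->.
by move=> /Fx[n _ CB]; exists n.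
Qed.

Lemma cylinderE (S : set nat) (a : seq bool) :
  cylinder S a = [set x | window (symbol x) 0 (size a) = a].
Proof. by []. Qed.

Lemma open_cylinder (S : set nat) (a : seq bool) : open (cylinder S a).
Proof.
have -> : cylinder S a = \bigcap_(i in [set i | (i < size a)%N])
    [set x | symbol x i = nth false a i].
  rewrite predeqE => x; split=> [<- i /= ia|xa].
    by rewrite size_mkseq in ia; rewrite nth_mkseq.
  apply: (@eq_from_nth _ false); rewrite size_mkseq// => i ia.
  by rewrite nth_mkseq// xa.
rewrite bigcap_mkord; elim/big_ind : _ => [|A B oA oB|i _]; first exact: openT.
  exact: openI.
exists [set x : cantor_space | x i = nth false a i] => //.
have -> : [set x : cantor_space | x i = nth false a i] =
    proj i @^-1` [set nth false a i] by [].
apply: open_comp => [x _|]; first exact: proj_continuous.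
exact: discrete_open.
Qed.

Lemma open_cylinderP (S : set nat) (A : set (gap_space S)) (x : gap_space S) :
  open A -> A x -> exists n, cylinder S (window (symbol x) 0 n) `<=` A.
Proof.
move=> [B oB <-] Bx.
have /nbhs_cantor_window[n nB] : nbhs (val x : cantor_space) B.
  by apply: open_nbhs_nbhs; split.
by exists n => y; rewrite cylinderE /= size_window => /nB.
Qed.

Lemma open_bigcup_cylinder (S : set nat) (A : set (gap_space S)) : open A ->
  A = \bigcup_(a in [set a | cylinder S a `<=` A]) cylinder S a.
Proof.
move=> oA; rewrite predeqE => x; split=> [Ax|[a + xa]]; last exact.
have [n nA] := open_cylinderP oA Ax.
by exists (window (symbol x) 0 n) => //; rewrite cylinderE /= size_window.
Qed.

Lemma measurable_cylinder (S : set nat) (a : seq bool) :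
  measurable (cylinder S a : set (borel_gap_space S)).
Proof. by apply: sub_sigma_algebra; exact: open_cylinder. Qed.

(** Words are countable, so an open set is a countable union of cylinders. *)
Lemma measurable_fun_cylinder (S : set nat) d (T : measurableType d)
    (f : T -> borel_gap_space S) :
  (forall a, measurable (f @^-1` cylinder S a)) -> measurable_fun setT f.
Proof.
move=> fcyl.
apply: (@measurability _ _ T (borel_gap_space S) setT f (@open (gap_space S))) => //.
move=> _ [A oA <-]; rewrite setTI (open_bigcup_cylinder oA) preimage_bigcup.
rewrite bigcup_mkcond; apply: countable_bigcupT_measurable => [|a].
  exact: countableP.
by case: ifP => _ //; exact: fcyl.
Qed.

Definition cylinders (S : set nat) : set (set (gap_space S)) :=
  [set A | A = set0 \/ exists a, A = cylinder S a].
Arguments cylinders S : clear implicits.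

Lemma borel_gap_spaceE (S : set nat) :
  @measurable _ (borel_gap_space S) = <<s cylinders S >>.
Proof.
rewrite eqEsubset; split=> [A mA|].
  (* [measurable_fun_cylinder] applies to the identity map into the Borel sets
     from the sigma-algebra that the cylinders generate. *)
  pose T := g_sigma_algebraType (cylinders S).
  have mid : measurable_fun setT (id : T -> borel_gap_space S).
    apply: measurable_fun_cylinder => a; apply: sub_sigma_algebra.
    by right; exists a.
  by have := mid measurableT _ mA; rewrite setTI preimage_id.
apply: smallest_sub; first exact: sigma_algebra_measurable.
move=> _ [->|[a ->]]; [exact: measurable0|exact: measurable_cylinder].
Qed.

Lemma setI_closed_cylinders (S : set nat) : setI_closed (cylinders S).
Proof.
have short (a b : seq bool) : (size a <= size b)%N ->
    cylinders S (cylinder S a `&` cylinder S b).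
  move=> ab; have [tba|tba] := eqVneq (take (size a) b) a.
    right; exists b; rewrite setIC; apply/setIidPl => x; rewrite !cylinderE /= => xb.
    by rewrite (@window_prefix _ 0 _ (size b))// drop0 xb.
  left; rewrite -subset0 => x []; rewrite !cylinderE /= => xa xb.
  have := @window_prefix (symbol x) 0 _ _ ab; rewrite drop0 xa xb => taE.
  by rewrite -taE eqxx in tba.
move=> _ _ [->|[a ->]] [->|[b ->]]; rewrite ?set0I ?setI0; try by left.
have [ab|/ltnW ba] := leqP (size a) (size b); first exact: short.
by rewrite setIC; exact: short.
Qed.

Lemma eq_probability_cylinder (R : realType) (S : set nat)
    (mu nu : {measure set (borel_gap_space S) -> \bar R}) :
  (mu setT < +oo)%E ->
  (forall a, mu (cylinder S a) = nu (cylinder S a)) ->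
  forall A, measurable A -> mu A = nu A.
Proof.
move=> muT munu A mA.
have setTE : setT = cylinder S [::] by rewrite predeqE.
apply: (@measure_unique _ R (borel_gap_space S) (cylinders S) (fun=> setT)) => //.
- exact: borel_gap_spaceE.
- exact: setI_closed_cylinders.
- by move=> _; right; exists [::].
- by rewrite bigcup_const.
- by move=> _ [->|[a ->]]; rewrite ?measure0.
Qed.

(** * A Borel measure with given cylinder weights *)

Section coding.
Context {R : realType} (m : seq bool -> R).
Hypothesis mP : cylinder_weights m.

Let m0 a : 0 <= m a. Proof. by case: mP. Qed.
Let m1 : m [::] = 1. Proof. by case: mP. Qed.
Let mS a : m a = m (rcons a false) + m (rcons a true). Proof. by case: mP. Qed.

(** The left end of the interval of a word, which has length [m] of the word.
Words are stored with the last symbol first, so that the recursion goes from an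
interval to the interval that it subdivides: the symbol 0 takes the left part. *)
Fixpoint lower (r : seq bool) : R :=
  if r is b :: r' then lower r' + (if b then m (rcons (rev r') false) else 0)
  else 0.

Fixpoint code_rev (u : R) (n : nat) : seq bool :=
  if n is n'.+1 then
    let r := code_rev u n' in
    (lower r + m (rcons (rev r) false) <= u) :: r
  else [::].

Definition code (u : R) : nat -> bool := fun n => head false (code_rev u n.+1).

Lemma window_code u n : window (code u) 0 n = rev (code_rev u n).
Proof.
elim: n => // n IHn; rewrite windowS IHn add0n.
by rewrite /code /= rev_cons.
Qed.

Lemma lower_ge0 r : 0 <= lower r.
Proof. by elim: r => //= b r r0; rewrite addr_ge0//; case: b. Qed.

Lemma lower_consE b r :
  lower r <= lower (b :: r) /\
  lower (b :: r) + m (rev (b :: r)) <= lower r + m (rev r).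
Proof.
rewrite /= rev_cons; case: b; rewrite ?addr0 ?lerDl ?m0.
  by split => //; rewrite -addrA -mS.
by split => //; rewrite lerD2l [leRHS]mS lerDl.
Qed.

Lemma lower_le1 r : lower r + m (rev r) <= 1.
Proof.
elim: r => [|b r]; first by rewrite /= add0r /rev/= m1.
by apply: le_trans; exact: (lower_consE b r).2.
Qed.

Lemma code_itv u n : 0 <= u < 1 ->
  lower (code_rev u n) <= u < lower (code_rev u n) + m (rev (code_rev u n)).
Proof.
move=> u01; elim: n => [|n /andP[lu um]]; first by rewrite /= /rev/= m1 add0r.
rewrite /= rev_cons; case: ifPn => [->|]; first by rewrite -addrA -mS um.
by rewrite -ltNge addr0 lu.
Qed.

Lemma code_revP u r : 0 <= u < 1 ->
  (code_rev u (size r) == r) = (lower r <= u < lower r + m (rev r)).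
Proof.
move=> u01; apply/eqP/idP => [<-|]; first exact: code_itv.
elim: r => //= b r IHr /andP[lu um].
have [lr rm] := lower_consE b r.
have -> : code_rev u (size r) = r.
  by apply: IHr; rewrite (le_trans lr lu) (lt_le_trans um rm).
congr (_ :: _); move: lu um; rewrite rev_cons; case: b {lr rm} => /=.
  by move=> ->.
by rewrite addr0 => _; rewrite ltNge => /negbTE.
Qed.

Lemma window_codeP u a : 0 <= u < 1 ->
  (window (code u) 0 (size a) == a) =
  (lower (rev a) <= u < lower (rev a) + m a).
Proof.
move=> u01; have := code_revP (rev a) u01; rewrite revK size_rev => <-.
by rewrite window_code -[RHS](inj_eq (can_inj revK)) revK.
Qed.

(** [u] lies in the half-open interval of each of its prefixes, and such an
interval is empty when its length is 0: codes never meet a word of weight 0. *)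
Lemma code_gt0 u n : 0 <= u < 1 -> 0 < m (window (code u) 0 n).
Proof.
by move=> /(code_itv n); rewrite window_code => /andP[/le_lt_trans h /h]; rewrite ltrDl.
Qed.

End coding.

Section unit_probability.
Context {R : realType}.

Definition unit_lebesgue : set (measurableTypeR R) -> \bar R :=
  mrestr (@lebesgue_measure R) (measurable_itv `[0, 1[).

HB.instance Definition _ := Measure.on unit_lebesgue.

Let unit_lebesgueT : unit_lebesgue setT = 1%E.
Proof.
by rewrite /unit_lebesgue /mrestr setTI lebesgue_measure_itv/= lte01 oppr0 adde0.
Qed.

HB.instance Definition _ :=
  Measure_isProbability.Build _ _ _ unit_lebesgue unit_lebesgueT.

End unit_probability.

(** A violation of the gap condition shows in a finite prefix. *)
Lemma gap_shift_closed (S : set nat) (x : nat -> bool) :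
  (forall n, exists y : gap_space S, window (symbol y) 0 n = window x 0 n) ->
  gap_shift S x.
Proof.
move=> xS i j ij xi xj zeros.
have [y yx] := xS j.+1.
have xy k : (k <= j)%N -> symbol y k = x k.
  by move=> kj; have /(congr1 (nth false ^~ k)) := yx; rewrite !nth_mkseq.
have := set_mem (valP y); apply => //.
- by rewrite -/(symbol y i) xy// ltnW.
- by rewrite -/(symbol y j) xy.
- move=> k /andP[ik kj]; rewrite -/(symbol y k) xy ?(ltnW kj)//.
  by apply: zeros; rewrite ik.
Qed.

(** On [0, 1[ every prefix of a code has positive weight, so by closedness the
coding map takes its values in the gap shift everywhere, not just almost
everywhere. *)
Lemma exists_cylinder_probability (R : realType) (S : set nat)
    (m : seq bool -> R) :
  cylinder_weights m ->
  (forall a, 0 < m a -> exists y : gap_space S, window (symbol y) 0 (size a) = a) ->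
  exists mu : probability (borel_gap_space S) R,
    forall a, mu (cylinder S a) = (m a)%:E.
Proof.
move=> mP supp.
have codeS u : 0 <= u < 1 -> gap_shift S (code m u).
  move=> u01; apply: gap_shift_closed => n.
  have [y] := supp _ (code_gt0 mP n u01).
  by rewrite size_window; exists y.
have /choice[X XE] : forall u : R, exists y : borel_gap_space S,
    symbol (y : gap_space S) = if 0 <= u < 1 then code m u else fun=> false.
  move=> u; case: ifPn => [/codeS uS|_].
    by exists (exist _ (code m u) (mem_set uS)).
  by exists point.
have Xpre a : X @^-1` cylinder S a `&` `[0, 1[ =
    `[lower m (rev a), lower m (rev a) + m a[%classic.
  rewrite predeqE => u; rewrite cylinderE /= !in_itv/= XE; split.
    by move=> [+ u01]; rewrite u01 => /eqP; rewrite window_codeP.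
  move=> ua; have u01 : 0 <= u < 1.
    case/andP: ua => lu um; rewrite (le_trans _ lu) ?lower_ge0//=.
    by rewrite (lt_le_trans um)// -[X in m X]revK lower_le1.
  by rewrite u01; split => //; apply/eqP; rewrite window_codeP.
have mX : measurable_fun setT (X : measurableTypeR R -> borel_gap_space S).
  apply: measurable_fun_cylinder => a.
  have -> : X @^-1` cylinder S a = `[lower m (rev a), lower m (rev a) + m a[%classic `|`
      (X @^-1` cylinder S a `&` ~` `[0, 1[).
    by rewrite -Xpre -setIUr setUv setIT.
  apply: measurableU; first exact: measurable_itv.
  have [z|nz] := pselect (mkseq (fun=> false) (size a) = a).
    have -> : X @^-1` cylinder S a `&` ~` `[0, 1[ = ~` `[0, 1[%classic.
      apply/setIidPr => u; rewrite /= in_itv/= cylinderE /= XE => /negP/negbTE ->.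
      exact: z.
    by apply: measurableC; exact: measurable_itv.
  have -> : X @^-1` cylinder S a `&` ~` `[0, 1[ = set0; last exact: measurable0.
  rewrite -subset0 => u []; rewrite /= in_itv/= cylinderE /= XE => + /negP/negbTE u01.
  by rewrite u01.
pose Xm : {mfun measurableTypeR R >-> borel_gap_space S} :=
  HB.pack (X : measurableTypeR R -> borel_gap_space S)
    (isMeasurableFun.Build _ _ _ _ _ mX).
pose P : probability (measurableTypeR R) R := unit_lebesgue.
exists (distribution P Xm) => a.
rewrite /distribution /pushforward /= /unit_lebesgue /mrestr.
rewrite [X in lebesgue_measure X](Xpre a) lebesgue_measure_itv/= lte_fin ltrDl.
case: ifPn => [_|]; first by rewrite -EFinB addrAC subrr add0r.
have [m0 _ _] := mP; rewrite -leNgt => ma.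
by congr EFin; apply/eqP; rewrite eq_le m0 ma.
Qed.

(** * Invariance and entropy of the measure *)

Lemma symbol_iter_sigma (S : set nat) (x : gap_space S) i k :
  symbol (iter i sigma x) k = symbol x (i + k)%N.
Proof. by elim: i k => //= i IHi k; rewrite -[LHS]/(symbol _ k.+1) IHi addnS. Qed.

Lemma preimage_sigma_cylinder (S : set nat) (a : seq bool) :
  sigma @^-1` cylinder S a = cylinder S (false :: a) `|` cylinder S (true :: a).
Proof.
have shiftE (x : gap_space S) n :
    window (symbol x) 0 n.+1 = symbol x 0 :: window (symbol (sigma x)) 0 n.
  by rewrite window_cons.
rewrite predeqE => x; rewrite /setU /= !cylinderE /= !shiftE; split.
  by move=> ->; case: (symbol x 0); [right|left].
by case=> -[].
Qed.

Lemma measurable_sigma (S : set nat) :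
  measurable_fun setT (sigma : borel_gap_space S -> borel_gap_space S).
Proof.
apply: measurable_fun_cylinder => a; rewrite preimage_sigma_cylinder.
by apply: measurableU; exact: measurable_cylinder.
Qed.

Lemma cylinder_probability_invariant (R : realType) (S : set nat)
    (m : seq bool -> R) (mu : probability (borel_gap_space S) R) :
  (forall a, mu (cylinder S a) = (m a)%:E) ->
  (forall a, m a = m (false :: a) + m (true :: a)) ->
  invariant_measure mu sigma.
Proof.
move=> mum mcons A mA.
pose s : {mfun borel_gap_space S >-> borel_gap_space S} :=
  HB.pack (sigma : borel_gap_space S -> borel_gap_space S)
    (isMeasurableFun.Build _ _ _ _ _ (@measurable_sigma S)).
apply: (@eq_probability_cylinder R S (distribution mu s) mu _ _ A mA).
  by rewrite /= /distribution /pushforward preimage_setT probability_setT ltry.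
move=> a; rewrite -[LHS]/(mu (sigma @^-1` cylinder S a)) preimage_sigma_cylinder.
transitivity (mu (cylinder S (false :: a)) + mu (cylinder S (true :: a)))%E.
  apply: measureU; try exact: measurable_cylinder.
  by rewrite -subset0 => x []; rewrite !cylinderE /= !window_cons => -[-> _] [].
transitivity (m a)%:E; last exact/esym/mum.
by rewrite mcons EFinD !mum.
Qed.

Section symbol_partition.
Context {S : set nat}.

Definition first_symbol (x : gap_space S) : 'I_2 := inord (symbol x 0).

Definition itinerary_word n (a : {ffun 'I_n -> 'I_2}) : seq bool :=
  [seq a i == inord 1 | i <- enum 'I_n].

Lemma size_itinerary_word n a : size (@itinerary_word n a) = n.
Proof. by rewrite size_map size_enum_ord. Qed.

Lemma nth_itinerary_word n a (i : 'I_n) :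
  nth false (itinerary_word a) i = (a i == inord 1).
Proof. by rewrite (nth_map i) ?size_enum_ord// nth_ord_enum. Qed.

Lemma ord2_bool (b : bool) (j : 'I_2) :
  (inord b == j :> 'I_2) = (b == (j == inord 1)).
Proof.
rewrite -!val_eqE /= !inordK//; last by case: b.
by case: j => [] [|[|]]//= _; case: b.
Qed.

Lemma first_symbol_join_atom n (a : {ffun 'I_n -> 'I_2}) :
  @join_atom _ (borel_gap_space S) sigma 2 first_symbol n a =
  cylinder S (itinerary_word a).
Proof.
rewrite predeqE => x; rewrite cylinderE /= size_itinerary_word; split=> [xa|xa i].
  apply: (@eq_from_nth _ false); rewrite size_window ?size_itinerary_word// => i lt_in.
  rewrite nth_mkseq// (nth_itinerary_word a (Ordinal lt_in)).
  have /eqP := xa (Ordinal lt_in).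
  by rewrite /first_symbol ord2_bool symbol_iter_sigma addn0 => /eqP.
apply/eqP; rewrite /first_symbol ord2_bool symbol_iter_sigma addn0.
by rewrite -nth_itinerary_word -xa nth_mkseq.
Qed.

Lemma sum_itinerary_word (R : realType) n (F : seq bool -> R) :
  \sum_(a : {ffun 'I_n -> 'I_2}) F (itinerary_word a) = \sum_(b <- words n) F b.
Proof.
rewrite -(big_map (@itinerary_word n) predT F); apply: perm_big.
apply: uniq_perm; rewrite ?uniq_words//.
  rewrite map_inj_uniq ?index_enum_uniq// => a b /(congr1 (nth false)) ab.
  apply/ffunP => i.
  have ord2K (k : 'I_2) : inord (k == inord 1) = k by apply/eqP; rewrite ord2_bool.
  by rewrite -[LHS]ord2K -nth_itinerary_word ab nth_itinerary_word ord2K.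
move=> b; rewrite mem_words; apply/mapP/eqP => [[a _ ->]|bn].
  exact: size_itinerary_word.
exists [ffun i : 'I_n => inord (nth false b i)]; first exact: mem_index_enum.
apply: (@eq_from_nth _ false); rewrite bn ?size_itinerary_word// => i lt_in.
rewrite (nth_itinerary_word _ (Ordinal lt_in)) ffunE /=.
by rewrite ord2_bool eqxx eqb_id.
Qed.

(** The atoms of the joins of the partition by the first symbol are the
cylinders, so that [word_entropy] is the entropy of these joins. *)
Lemma measure_entropy_ge (R : realType) (m : seq bool -> R) (D : R)
    (mu : probability (borel_gap_space S) R) :
  (forall a, mu (cylinder S a) = (m a)%:E) ->
  (forall n, n%:R * D <= word_entropy m n) ->
  (D%:E <= h_mu mu)%E.
Proof.
move=> mum HD.
have mxi : @measurable_labelling _ (borel_gap_space S) 2 first_symbol.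
  move=> j; have -> : first_symbol @^-1` [set j] = cylinder S [:: j == inord 1].
    rewrite predeqE => x; rewrite cylinderE /= /window /mkseq /=; split.
      by move=> <-; rewrite /first_symbol ord2_bool eqxx eqb_id.
    by move=> [xj]; apply/eqP; rewrite /first_symbol ord2_bool xj.
  exact: measurable_cylinder.
apply: (@le_trans _ _ (partition_entropy mu sigma first_symbol)); last first.
  by apply: ereal_sup_ubound; exists 2, first_symbol.
have joinE n : join_entropy mu sigma first_symbol n = word_entropy m n.
  rewrite /word_entropy -sum_itinerary_word; apply: eq_bigr => a _.
  by rewrite first_symbol_join_atom mum.
rewrite /partition_entropy /limn_esup /limf_esup; apply: le_ereal_inf_tmp => _ [V ooV <-].
have [n [Vn n0]] : exists n, V n /\ (0 < n)%N.
  have := @filter_ex _ _ _ _ (filterI ooV (nbhs_infty_gt 0)).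
  by case=> n [Vn n0]; exists n.
apply: le_ereal_sup_tmp; exists ((join_entropy mu sigma first_symbol n / n%:R)%:E).
  by exists n.
by rewrite lee_fin joinE ler_pdivlMr ?ltr0n// mulrC.
Qed.

End symbol_partition.

(** * Measures of large entropy on a forward invariant set *)

Definition shift_language (S : set nat) (E : set (gap_space S)) :=
  language (@symbol S @` E).

Lemma word_of_symbol (S : set nat) (E : set (gap_space S)) a :
  word_of (@symbol S @` E) a <-> (E `&` cylinder S a) !=set0.
Proof.
split=> [[_ [x Ex <-] xa]|[x [Ex xa]]]; first by exists x.
by exists (symbol x) => //; exists x.
Qed.

Lemma exists_entropy_measure (R : realType) (S : set nat)
    (E : set (gap_space S)) (D : R) (N0 : nat) :
  (forall x, E x -> E (sigma x)) ->
  (forall N, (N0 <= N)%N -> expR (N%:R * D) <= (size (shift_language E N))%:R) ->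
  exists mu : probability (borel_gap_space S) R,
    [/\ invariant_measure mu sigma,
        forall a, E `&` cylinder S a = set0 -> mu (cylinder S a) = 0%E &
        (D%:E <= h_mu mu)%E].
Proof.
move=> Esigma Egrowth.
have Eshift x : (@symbol S @` E) x -> (@symbol S @` E) (fun i => x i.+1).
  by move=> [y Ey <-]; exists (sigma y) => //; exact: Esigma.
have [m [mP mcons m0 mD]] := limit_weights Eshift Egrowth.
have [a ma|mu mum] := @exists_cylinder_probability R S m mP.
  have [|/m0 ma0] := pselect (word_of (@symbol S @` E) a).
    by move=> /word_of_symbol[x [_ xa]]; exists x.
  by rewrite ma0 ltxx in ma.
exists mu; split.
- exact: cylinder_probability_invariant mum mcons.
- move=> a Ea; rewrite mum m0// => /word_of_symbol.
  by rewrite Ea => -[].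
- apply: measure_entropy_ge mum _ => n; exact: word_entropy_ge.
Qed.

(** * Metric estimates *)

Lemma limn_esup_le (R : realType) (u : (\bar R)^nat) (l : \bar R) (N : nat) :
  (forall n, (N <= n)%N -> u n <= l)%E -> (limn_esup u <= l)%E.
Proof.
move=> ul; apply: (@le_trans _ _ (ereal_sup (u @` [set n | (N <= n)%N]))).
  by apply: ereal_inf_lbound; exists [set n | (N <= n)%N] => //; exact: nbhs_infty_ge.
by apply: ge_ereal_sup => _ [n Nn <-]; exact: ul.
Qed.

Section metric.
Context {R : realType} (theta : R) (S : set nat).
Hypothesis theta_itv : 0 < theta < 1.

Let theta_ge0 : 0 <= theta. Proof. by case/andP: theta_itv => /ltW. Qed.
Let theta_le1 : theta <= 1. Proof. by case/andP: theta_itv => _ /ltW. Qed.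
Let theta_gt0 : 0 < theta. Proof. by case/andP: theta_itv. Qed.

Lemma d_theta_ge0 (x y : gap_space S) : 0 <= d_theta theta x y.
Proof. by rewrite /d_theta; case: pselect => // h; rewrite exprn_ge0. Qed.

Lemma d_theta_le (x y : gap_space S) n :
  window (symbol x) 0 n = window (symbol y) 0 n -> d_theta theta x y <= theta ^+ n.
Proof.
move=> xy; rewrite /d_theta; case: pselect => [h|_]; last by rewrite exprn_ge0.
case: ex_minnP => k xyk _; rewrite ler_wiXn2l// leqNgt; apply: contra xyk => kn.
by have /(congr1 (nth false ^~ k)) := xy; rewrite !nth_mkseq// => /eqP.
Qed.

Lemma d_theta_ge (x y : gap_space S) n :
  window (symbol x) 0 n != window (symbol y) 0 n -> theta ^+ n <= d_theta theta x y.
Proof.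
move=> xy; have [k kn xyk] : exists2 k, (k < n)%N & symbol x k != symbol y k.
  apply: contrapT => h; case/eqP: xy; apply: (@eq_from_nth _ false).
    by rewrite !size_window.
  move=> i; rewrite size_window => lt_in; rewrite !nth_mkseq//.
  by apply/eqP/negPn/negP => xyi; apply: h; exists i.
rewrite /d_theta; case: pselect => [h|[]]; last by exists k.
case: ex_minnP => j _ /(_ k xyk) jk; rewrite ler_wiXn2l//.
by rewrite ltnW// (leq_ltn_trans jk).
Qed.

Lemma diameter_ge0 (U : set (gap_space S)) : (0 <= diameter (d_theta theta) U)%E.
Proof. by apply: ereal_sup_ubound; left. Qed.

Lemma diameter_set0 : diameter (@d_theta R theta S) set0 = 0%E.
Proof.
apply/eqP; rewrite eq_le diameter_ge0 andbT.
by apply: ge_ereal_sup => z [->//|[x [y []]]].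
Qed.

Lemma diameter_cylinder a :
  (diameter (d_theta theta) (cylinder S a) <= (theta ^+ size a)%:E)%E.
Proof.
apply: ge_ereal_sup => _ [->|[x [y [xa ya ->]]]]; rewrite lee_fin ?exprn_ge0//.
by apply: d_theta_le; move: xa ya; rewrite !cylinderE /= => -> ->.
Qed.

(** The sum of the diameters to the power [s] over the cylinders of length [N] is
less than rho^N with rho = e^(D - s (- log theta)) < 1, for infinitely many
[N]. *)
Lemma hausdorff_measure_eq0 (E : set (gap_space S)) (s D : R) :
  0 < s -> D < s * - ln theta ->
  (forall N0, exists2 N, (N0 <= N)%N &
     (size (shift_language E N))%:R < expR (N%:R * D)) ->
  hausdorff_measure (d_theta theta) s E = 0%E.
Proof.
move=> s0 Ds Egrowth.
have content_ge0 delta : (0 <= hausdorff_content (d_theta theta) s delta E)%E.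
  apply: le_ereal_inf_tmp => _ [U _ <-]; apply: nneseries_ge0 => i _ _.
  exact: poweR_ge0.
suff content0 delta : 0 < delta -> hausdorff_content (d_theta theta) s delta E = 0%E.
  apply/eqP; rewrite eq_le; apply/andP; split.
    by apply: ge_ereal_sup => _ [delta delta0 <-]; rewrite content0.
  apply: le_ereal_sup_tmp; exists (hausdorff_content (d_theta theta) s 1 E) => //.
  by exists 1 => //=.
move=> delta0; apply/eqP; rewrite eq_le content_ge0 andbT.
apply/lee_addgt0Pr => e e0; rewrite add0e.
pose rho := expR (D + s * ln theta).
have rho0 : 0 < rho by exact: expR_gt0.
have rho1 : `|rho| < 1.
  by rewrite ger0_norm ?ltW// -[ltRHS]expR0 ltr_expR; lra.
have theta1 : `|theta| < 1 by rewrite ger0_norm; case/andP: theta_itv.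
have rhoN : \forall N \near \oo, rho ^+ N <= e.
  by apply: (cvgr_le _ (cvg_expr rho1)).
have thetaN : \forall N \near \oo, theta ^+ N <= delta.
  by apply: (cvgr_le _ (cvg_expr theta1)).
have [N0 _ small] := filterI rhoN thetaN.
have [N N0N LN] := Egrowth N0; have [{}rhoN {}thetaN] := small N N0N.
pose L := shift_language E N.
have sizeL i : (i < size L)%N -> size (nth [::] L i) = N.
  by move=> /(mem_nth [::]); rewrite mem_filter mem_words => /andP[_ /eqP].
pose U i := if (i < size L)%N then cylinder S (nth [::] L i) else set0.
have diamU i : (diameter (d_theta theta) (U i) <= (theta ^+ N)%:E)%E.
  rewrite /U; case: ifPn => [iL|_].
    by rewrite -(sizeL _ iL); exact: diameter_cylinder.
  by rewrite diameter_set0 lee_fin exprn_ge0.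
apply: (@le_trans _ _ (\sum_(0 <= i <oo) diameter (d_theta theta) (U i) `^ s)%E).
  apply: ereal_inf_lbound; exists U => //; split; last first.
    by move=> i; apply: le_trans (diamU i) _; rewrite lee_fin.
  move=> x Ex; have xL : window (symbol x) 0 N \in L.
    rewrite mem_filter mem_words size_window eqxx andbT; apply/asboolP.
    by apply/word_of_symbol; exists x; rewrite cylinderE /= size_window.
  exists (index (window (symbol x) 0 N) L) => //.
  by rewrite /U index_mem xL nth_index// cylinderE /= size_window.
rewrite (nneseries_split 0 (size L)); last by move=> k _; exact: poweR_ge0.
rewrite add0n eseries0 ?adde0; last first.
  move=> i Li _; rewrite /U ltnNge Li /= diameter_set0 poweR0r//.
  by rewrite gt_eqF.
apply: (@le_trans _ _ (\sum_(0 <= i < size L) (expR (N%:R * (s * ln theta)))%:E)%E).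
  apply: lee_sum => i _.
  have -> : (expR (N%:R * (s * ln theta)))%:E = ((theta ^+ N)%:E `^ s)%E.
    rewrite poweR_EFin /powR gt_eqF ?exprn_gt0// lnXn// -mulr_natl.
    by congr (expR _)%:E; ring.
  apply: gt0_ler_poweR => //; first exact: ltW.
    by rewrite in_itv/= leey andbT diameter_ge0.
  by rewrite in_itv/= leey andbT lee_fin exprn_ge0.
rewrite sumEFin lee_fin big_const_nat subn0 iter_addr_0 -[_ *+ size L]mulr_natl.
apply: le_trans rhoN; rewrite /rho -expRM_natl mulrDr expRD.
by rewrite ler_wpM2r ?expR_ge0// ltW.
Qed.

Lemma hausdorff_dim_le (E : set (gap_space S)) (t : R) :
  0 <= t -> (forall s, t < s -> hausdorff_measure (d_theta theta) s E = 0%E) ->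
  (hausdorff_dim (d_theta theta) E <= t%:E)%E.
Proof.
move=> t0 Ht; apply/lee_addgt0Pr => e e0; apply: ereal_inf_lbound.
exists (t + e); last by rewrite EFinD.
by split; [exact: ltr_wpDl|apply: Ht; rewrite ltrDl].
Qed.

(** For theta^M <= eps, points that are (n, eps)-separated have distinct prefixes
of length n + M, so there are at most 2^(n + M) of them.  The exponent is at
most 2 n once M < n, whence the factor 2 for a bound that does not depend on
[eps]. *)
Lemma h_top_le : (h_top S theta <= (2 * ln 2)%:E)%E.
Proof.
apply: ge_ereal_sup => _ [eps /= eps0 <-].
have theta1 : `|theta| < 1 by rewrite ger0_norm; case/andP: theta_itv.
have [M _ /(_ M (leqnn M)) thetaM] : \forall N \near \oo, theta ^+ N <= eps.
  by apply: (cvgr_le _ (cvg_expr theta1)).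
apply: (@limn_esup_le _ _ _ M.+1) => n Mn.
have n0 : 0 < n%:R :> R by rewrite ltr0n (leq_ltn_trans _ Mn).
rewrite lee_pdivrMl// -EFinM; apply: ge_ereal_sup => _ [E [uE sepE] <-].
rewrite lee_fin.
have sizeE : (size E <= 2 ^ (n + M))%N.
  rewrite -size_words -(size_map (fun x => window (symbol x) 0 (n + M)) E).
  apply: uniq_leq_size => [|_ /mapP[x _ ->]]; last by rewrite mem_words size_window.
  rewrite map_inj_in_uniq// => x y xE yE xy.
  apply/eqP/negPn/negP => /(sepE _ _ xE yE)[k kn].
  rewrite ltNge => /negP; apply; apply: le_trans thetaM; apply: d_theta_le.
  apply: (@eq_from_nth _ false) => [|i]; rewrite !size_window// => iM.
  rewrite !nth_mkseq// !symbol_iter_sigma.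
  have kiN : (k + i < n + M)%N by lia.
  by have /(congr1 (nth false ^~ (k + i)%N)) := xy; rewrite !nth_mkseq.
have [E0|E0] := posnP (size E).
  by rewrite E0 ln0// mulr_ge0 ?mulr_ge0 ?ln_ge0 ?ler1n.
apply: (@le_trans _ _ ((n + M)%:R * ln 2)).
  rewrite mulr_natl -lnXn// ler_ln ?posrE ?exprn_gt0 ?ltr0n//.
  by rewrite -natrX ler_nat.
rewrite mulrA ler_wpM2r ?ln_ge0 ?ler1n// -natrM ler_nat; lia.
Qed.

(** The indicator takes the same value at points that agree on the first
[size a] symbols, and other points are at distance at least theta^(size a). *)
Lemma holder_norm_cylinder_lty a :
  (holder_norm (@d_theta R theta S) (\1_(cylinder S a)) < +oo)%E.
Proof.
apply: (@le_lt_trans _ _ (1 + (theta ^- size a)%:E)%E); last by rewrite ltry.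
have indic01 x : `|\1_(cylinder S a) x| <= 1 :> R.
  by rewrite indicE; case: (_ \in _); rewrite ?normr1 ?normr0.
apply: leeD; first by apply: ge_ereal_sup => _ [x _ <-]; rewrite lee_fin.
apply: ge_ereal_sup => _ [[x y] _ <-]; rewrite lee_fin /=.
have inv_ge0 : 0 <= theta ^- size a by rewrite invr_ge0 exprn_ge0.
have [xy|xy] := eqVneq (window (symbol x) 0 (size a)) (window (symbol y) 0 (size a)).
  rewrite !indicE; have -> : (x \in cylinder S a) = (y \in cylinder S a).
    by apply/idP/idP; rewrite !inE !cylinderE /= xy.
  by rewrite subrr normr0 mul0r.
apply: (@le_trans _ _ (1 / d_theta theta x y)).
  rewrite ler_wpM2r ?invr_ge0 ?d_theta_ge0// !indicE.
  by case: (x \in _); case: (y \in _);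
     rewrite ?subrr ?subr0 ?sub0r ?normrN ?normr1 ?normr0.
rewrite div1r lef_pV2 ?posrE ?exprn_gt0//; first exact: d_theta_ge.
by rewrite (lt_le_trans _ (d_theta_ge xy))// exprn_gt0.
Qed.

Lemma holder_norm_cylinder_gt0 a : cylinder S a !=set0 ->
  (0 < holder_norm (@d_theta R theta S) (\1_(cylinder S a)))%E.
Proof.
move=> [x xa]; apply: (@lt_le_trans _ _ (1 + 0)%E); first by rewrite adde0 lte01.
apply: leeD.
  apply: ereal_sup_ubound; exists x => //.
  by rewrite indicE mem_set//= normr1.
apply: le_ereal_sup_tmp; exists 0%E => //; exists (x, x) => //=.
by rewrite subrr normr0 mul0r.
Qed.

End metric.

(** * The entropy gap and the dimension bound *)

Lemma escape_set_sigma (X : Type) (T : X -> X) (C : set X) x :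
  escape_set T C x -> escape_set T C (T x).
Proof. by move=> Cx k; rewrite -iterSr; exact: Cx. Qed.

Lemma Rintegral_indic_probability (R : realType) d (T : measurableType d)
    (mu : probability T R) (A : set T) :
  measurable A -> Rintegral mu setT (\1_A) = fine (mu A).
Proof. by move=> mA; rewrite /Rintegral integral_indic// setIT. Qed.

Lemma kappa_gt0 (R : realType) (S : set nat) (theta : R) (w : seq bool)
    (mu0 : probability (borel_gap_space S) R) (Ceff : R) :
  0 < theta < 1 -> 0 < Ceff -> (0 < mu0 (cylinder S w))%E ->
  0 < kappa theta mu0 Ceff (cylinder S w).
Proof.
move=> theta_itv Ceff_gt0 C_gt0.
have C0 : cylinder S w !=set0.
  by apply/set0P/negP => /eqP C0; move: C_gt0; rewrite C0 measure0 ltxx.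
have norm_gt0 := holder_norm_cylinder_gt0 theta C0.
have norm_lty := holder_norm_cylinder_lty S theta_itv w.
have p_gt0 : 0 < fine (mu0 (cylinder S w)).
  rewrite fine_gt0// C_gt0 /= (le_lt_trans (probability_le1 _ _)) ?ltry//.
  exact: measurable_cylinder.
have n_gt0 : 0 < fine (holder_norm (@d_theta R theta S) (\1_(cylinder S w))).
  by rewrite fine_gt0// norm_gt0.
by rewrite /kappa divr_gt0 ?(exprn_gt0 _ p_gt0)// mulr_gt0 ?exprn_gt0.
Qed.

(** For the indicator of a cylinder that is null for [mu], the left side of the
effective inequality is [mu0] of the cylinder; squaring and solving for the
entropy gives [kappa]. *)
Lemma entropy_gap (R : realType) (S : set nat) (theta : R) (w : seq bool)
    (mu0 mu : probability (borel_gap_space S) R) (Ceff : R) (D hr : R) :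
  0 < theta < 1 -> 0 < Ceff -> (0 < mu0 (cylinder S w))%E ->
  effective_constant theta mu0 Ceff -> h_top S theta = hr%:E ->
  invariant_measure mu sigma -> mu (cylinder S w) = 0%E ->
  (D%:E <= h_mu mu)%E ->
  D <= hr - kappa theta mu0 Ceff (cylinder S w).
Proof.
move=> theta_itv Ceff_gt0 C_gt0 bound hrE mu_inv muC Dmu.
set C := cylinder S w in C_gt0 muC *.
have mC : measurable (C : set (borel_gap_space S)) by exact: measurable_cylinder.
have C0 : C !=set0.
  by apply/set0P/negP => /eqP C0; move: C_gt0; rewrite C0 measure0 ltxx.
have norm_gt0 := holder_norm_cylinder_gt0 theta C0.
have norm_lty := holder_norm_cylinder_lty S theta_itv w.
have := bound mu (\1_C) mu_inv norm_lty.
rewrite /kappa !(Rintegral_indic_probability _ mC) muC fine0 sub0r normrN.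
have p_gt0 : 0 < fine (mu0 C).
  by rewrite fine_gt0// C_gt0 /= (le_lt_trans (probability_le1 _ mC)) ?ltry.
move: norm_gt0 norm_lty; rewrite -/C.
case: (holder_norm _ _) => [n| |]//; rewrite lte_fin /= => n_gt0 _.
set p := fine (mu0 C) in p_gt0 *; rewrite (ger0_norm (ltW p_gt0)) => pbound.
(* The maximum with 0 covers the case D > hr, where the square root vanishes. *)
rewrite leNgt; apply/negP => Dk; pose k' := Num.max (hr - D) 0.
have k'0 : 0 <= k' by rewrite le_max lexx orbT.
have sqrt_le : (sqrte (h_top S theta - h_mu mu) <= (Num.sqrt k')%:E)%E.
  rewrite -[leRHS]/(sqrte k'%:E) lee_sqrt ?lee_fin// hrE.
  apply: (@le_trans _ _ (hr%:E - D%:E)%E); first by rewrite leeB.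
  by rewrite -EFinB lee_fin le_max lexx.
have {pbound sqrt_le} : (p%:E <= (Ceff * n * Num.sqrt k')%:E)%E.
  apply: le_trans pbound _; rewrite !EFinM lee_pmul2l// -EFinM.
  by rewrite lte_fin mulr_gt0.
rewrite lee_fin => ple.
have psq : p ^+ 2 <= Ceff ^+ 2 * n ^+ 2 * k'.
  rewrite -[X in _ * X]sqr_sqrtr// -!exprMn lerXn2r ?nnegrE ?(ltW p_gt0)//.
  by rewrite ltW// (lt_le_trans p_gt0).
have cn : 0 < Ceff ^+ 2 * n ^+ 2 by rewrite mulr_gt0 ?exprn_gt0.
move: psq; rewrite -ler_pdivrMl// mulrC; apply/negP; rewrite -ltNge.
by rewrite gt_max divr_gt0 ?exprn_gt0// andbT; lra.
Qed.

(** If the language of E were to grow at least like e^(N D) for all large N, the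
measure of [exists_entropy_measure] would have entropy at least D, against
[entropy_gap]. *)
Theorem corollary7p4 (R : realType) (S : set nat) (theta : R)
    (S_nonempty : S !=set0) (theta_itv : 0 < theta < 1)
    (h_top_gt0 : (0 < h_top S theta)%E)
    (mu0 : probability (borel_gap_space S) R)
    (mu0_max : max_entropy_measure theta mu0)
    (Ceff : R) (Ceff_gt0 : 0 < Ceff)
    (Ceff_bound : effective_constant theta mu0 Ceff)
    (w : seq bool) (w_admissible : admissible S w) (w_size : (1 <= size w)%N)
    (C_gt0 : (0 < mu0 (cylinder S w))%E) :
  let C := cylinder S w in
  let khat := kappa_hat theta mu0 Ceff C in
  let dimE := hausdorff_dim (@d_theta R theta S) (escape_set (@sigma S) C) in
  [/\ (0 < khat)%E,
      (dimE <= (h_top S theta - khat) * ((- ln theta)^-1)%:E)%E &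
      ((h_top S theta - khat) * ((- ln theta)^-1)%:E <
        h_top S theta * ((- ln theta)^-1)%:E)%E].
Proof.
move=> C khat dimE.
have [hr hrE] : exists hr, h_top S theta = hr%:E.
  exists (fine (h_top S theta)); rewrite fineK// ge0_fin_numE ?ltW//.
  exact: le_lt_trans (h_top_le _ theta_itv) (ltry _).
have hr_gt0 : 0 < hr by rewrite hrE in h_top_gt0.
pose K := kappa theta mu0 Ceff C.
have K_gt0 : 0 < K by exact: kappa_gt0.
pose k := Num.min K (2^-1 * hr).
have khatE : khat = k%:E by rewrite /khat /kappa_hat hrE -EFinM EFin_min.
have k_gt0 : 0 < k by rewrite lt_min K_gt0 mulr_gt0// invr_gt0.
have kK : k <= K by rewrite ge_min lexx.
have khr : k <= 2^-1 * hr by rewrite ge_min lexx orbT.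
have L_gt0 : 0 < - ln theta by rewrite oppr_gt0 ln_lt0.
split; first by rewrite khatE.
- rewrite hrE khatE -EFinB -EFinM; apply: hausdorff_dim_le.
    by rewrite divr_ge0 ?ltW//; lra.
  move=> s ts; rewrite ltr_pdivrMr// in ts.
  have s_gt0 : 0 < s by rewrite -(pmulr_lgt0 _ L_gt0); lra.
  (* Any D strictly between h_top - kappa_hat and s (- log theta) would do. *)
  pose D := ((hr - k) + s * - ln theta) / 2.
  apply: (@hausdorff_measure_eq0 _ _ _ theta_itv _ _ D) => //; first by rewrite /D; lra.
  move=> N0; apply: contrapT => noN.
  have [N N0N|mu [mu_inv mu0C Dmu]] :=
      @exists_entropy_measure R S (escape_set sigma C) D N0 (@escape_set_sigma _ _ _).
    by rewrite leNgt; apply/negP => LN; apply: noN; exists N.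
  have := entropy_gap theta_itv Ceff_gt0 C_gt0 Ceff_bound hrE mu_inv (mu0C w _) Dmu.
  suff EC : escape_set sigma C `&` C = set0 by move=> /(_ EC); rewrite -/C -/K /D; lra.
  by rewrite -subset0 => x [/(_ 0%N)].
- rewrite hrE khatE -EFinB -!EFinM lte_fin ltr_pM2r ?invr_gt0//.
  by rewrite ltrBlDr ltrDl.
Qed.
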